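(* For any integer $k>0$, $$ \big(\widetilde D_N\big)^k=\sum_{j=0}^{k}\varphi_{q,\frac{x_{N+1}}{x_N}}(j\mid k)\,(D_N)^j\,(D_{N+1})^{k-j}. $$
   Context: Let $q$ be a parameter and $x_1,\dots,x_{N+1}$ independent variables, $N\ge 1$. $\Gamma_i=q^{x_i\partial_{x_i}}$ denotes the $q$-shift operator replacing $x_i$ by $qx_i$ and fixing the other variables. Functions of the variables act by multiplication, and products of operators are compositions in the order written (so the coefficients $\varphi$ in the claim multiply on the left). The first $q$-Whittaker operator of rank $N$ in the variables $x_1,\dots,x_N$ is $$D_N=D_N(x_1,\dots,x_N):=\sum_{i=1}^{N}\Bigg(\prod_{\substack{1\le j\le N\\ j\neq i}}\frac{x_i}{x_i-x_j}\Bigg)\Gamma_i .$$ Likewise $D_{N+1}=D_{N+1}(x_1,\dots,x_{N+1})$ is the same operator of rank $N+1$ in the variables $x_1,\dots,x_{N+1}$, and $\widetilde D_N:=D_N(x_1,\dots,x_{N-1},x_{N+1})$ is the rank $N$ operator in the variables $x_1,\dots,x_{N-1},x_{N+1}$, that is, $$\widetilde D_N=\sum_{i\in A}\Bigg(\prod_{j\in A\setminus\{i\}}\frac{x_i}{x_i-x_j}\Bigg)\Gamma_i,\qquad A=\{1,\dots,N-1,N+1\}.$$ For integers $0\le j\le k$ and a parameter $\alpha$, $$\varphi_{q,\alpha}(j\mid k):=\alpha^j\,(\alpha;q)_{k-j}\,\frac{(q;q)_k}{(q;q)_{k-j}(q;q)_j},\qquad (b;q)_n:=\prod_{r=0}^{n-1}(1-bq^r),\quad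 (b;q)_0:=1 .$$
   Formalization: The coefficients of the q-Whittaker operators are taken as x_j/(x_j−x_i) instead of the printed x_i/(x_i−x_j), for which the identity fails (e.g. N=k=1); q is assumed nonzero with q^m≠1 for 1≤m≤k so that Γ_i and φ are defined. *)

(* Defs.v *)
From HB Require Import structures.
From mathcomp Require Import all_boot all_order all_algebra.
From mathcomp Require Import mpoly.

Set Implicit Arguments.
Unset Strict Implicit.
Unset Printing Implicit Defensive.

Import GRing.Theory.

Local Open Scope ring_scope.

(* the field F(x_0, ..., x_(n-1)) of rational functions in n variables *)
Notation ratfun F n := {fraction {mpoly F[n]}}.

Section Whittaker.
Variables (F : fieldType) (n : nat).

Definition ratC (c : F) : ratfun F n := FracField.tofrac c%:MP_[n].
Definition ratX (i : 'I_n) : ratfun F n := FracField.tofrac ('X_i : {mpoly F[n]}).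

(* the substitution x_i := q x_i on polynomials *)
Definition mpoly_qshift (q : F) (i : 'I_n) (p : {mpoly F[n]}) : {mpoly F[n]} :=
  p \mPo [tuple (if j == i then q *: 'X_j else 'X_j) | j < n].

(* The q-shift Gamma_i on rational functions, computed on some representative
   numerator / denominator; see qshift_frac for the independence of the
   representative, which requires q != 0. *)
Definition qshift (q : F) (i : 'I_n) (f : ratfun F n) : ratfun F n :=
  FracField.tofrac (mpoly_qshift q i \n_(repr f)) /
  FracField.tofrac (mpoly_qshift q i \d_(repr f)).

(* The first q-Whittaker operator in the variables indexed by A, i.e. the first
   Macdonald operator
     \sum_i (\prod_(j != i) (t x_i - x_j) / (x_i - x_j)) Gamma_i
   at t = 0.  The numerators are x_j.  A source that prints the factors as
   x_i / (x_i - x_j) (the t -> oo normalization), while keeping the weights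
   phi at alpha = x_(N+1) / x_N, makes the power identity false: for two
   variables and k = 1, the right-hand side applied to x_1 would be
   q x_1 + (q - 1) x_2 instead of x_1. *)
Definition qWhittaker (q : F) (A : {set 'I_n}) (f : ratfun F n) : ratfun F n :=
  \sum_(i in A)
    (\prod_(j in A | j != i) (ratX j / (ratX j - ratX i))) * qshift q i f.

End Whittaker.

Definition qPochhammer (K : fieldType) (q b : K) (n : nat) : K :=
  \prod_(r < n) (1 - b * q ^+ r).

Definition qphi (K : fieldType) (q alpha : K) (j k : nat) : K :=
  alpha ^+ j * qPochhammer q alpha (k - j) *
  (qPochhammer q q k / (qPochhammer q q (k - j) * qPochhammer q q j)).

Section QShiftFacts.
Variables (F : fieldType) (n : nat) (q : F) (i : 'I_n).
Hypothesis q_neq0 : q != 0.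

Lemma mpoly_qshiftX j :
  mpoly_qshift q i 'X_j = (if j == i then q *: 'X_j else 'X_j).
Proof. by rewrite /mpoly_qshift comp_mpolyXU -tnth_nth tnth_mktuple. Qed.

Lemma mpoly_qshiftK : cancel (mpoly_qshift q i) (mpoly_qshift q^-1 i).
Proof.
move=> p; rewrite {2}/mpoly_qshift comp_mpolyE /mpoly_qshift raddf_sum /=.
rewrite [RHS]mpolyE; apply: eq_bigr => m _.
rewrite comp_mpolyZ rmorph_prod /= mpolyXE_id; congr (_ *: _).
apply: eq_bigr => j _; rewrite rmorphXn /= tnth_mktuple; congr (_ ^+ _).
case: ifP => ji; rewrite ?comp_mpolyZ comp_mpolyXU -tnth_nth tnth_mktuple ji //.
by rewrite scalerA divff // scale1r.
Qed.

Lemma mpoly_qshift_eq0 p : (mpoly_qshift q i p == 0) = (p == 0).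
Proof.
have s0 c : mpoly_qshift c i 0 = 0 by rewrite /mpoly_qshift comp_mpoly0.
apply/eqP/eqP => [p0|->]; last exact: s0.
by rewrite -(mpoly_qshiftK p) p0 s0.
Qed.

Lemma ratfunE (f : ratfun F n) :
  f = FracField.tofrac \n_(repr f) / FracField.tofrac \d_(repr f).
Proof.
have dn0 := denom_ratioP (repr f).
apply: (canRL (mulfK _)); first by rewrite tofrac_eq0.
rewrite -{1}[f]reprK; move: (repr f) dn0 => x dx0.
rewrite /GRing.mul /= !piE; apply/eqP; rewrite eqmodE /= FracField.equivfE.
by rewrite /FracField.mulf !numden_Ratio ?oner_eq0 ?mulr1 // mulrC.
Qed.

Lemma qshift_frac (p d : {mpoly F[n]}) : d != 0 ->
  qshift q i (FracField.tofrac p / FracField.tofrac d) =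
  FracField.tofrac (mpoly_qshift q i p) / FracField.tofrac (mpoly_qshift q i d).
Proof.
move=> d0; rewrite /qshift.
set f := FracField.tofrac p / FracField.tofrac d.
have dr0 := denom_ratioP (repr f).
have /eqP := ratfunE f; rewrite {1}/f eqr_div ?tofrac_eq0 //.
rewrite -!tofracM tofrac_eq => /eqP E.
apply/eqP; rewrite eqr_div ?tofrac_eq0 ?mpoly_qshift_eq0 // -!tofracM tofrac_eq.
by rewrite /mpoly_qshift -!rmorphM E mulrC.
Qed.

End QShiftFacts.

(* Main.v *)
Require Import Defs.
From mathcomp Require Import all_boot all_order all_algebra.
From mathcomp Require Import mpoly ring.

Set Implicit Arguments.
Unset Strict Implicit.
Unset Printing Implicit Defensive.

Import GRing.Theory.

Local Open Scope ring_scope.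

(** Let [w_l] be the coefficients of the operator in all the variables and put

      [E0 = \sum_l w_l Gamma_l],   [E1 = \sum_l x_l w_l Gamma_l].

    Leaving the variable [x_i] out of the operator amounts to multiplying each
    [w_l] by [1 - x_l / x_i], so the three operators of the identity are
    [E0 - E1 / x_N], [E0 - E1 / x_(N+1)] and [E0] ([qWhittaker_setC1]).  The
    scalar [1 / x_i] does not commute with [E0] and [E1], but it commutes with
    the combination [E0 - x_i^-1 E1], in which [Gamma_i] does not occur; powers
    of this combination can therefore be expanded as if [x_i] were a central
    parameter.

    The second point is the relation [E0 E1 = q E1 E0] ([qdiff_qcomm]).  The
    q-binomial theorem then gives ([qWhittaker_setC1_iter])

      [(E0 - x_i^-1 E1)^k = \sum_m [k m] (- x_i^-1)^m E1^m E0^(k - m)],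

    where [[k m]] is a Gaussian binomial.  Both sides of the theorem thereby
    become combinations of the [E1^m E0^(k - m)] with coefficients on the left,
    and comparing them term by term leaves a statement about the weights alone,

      [\sum_j phi_alpha(j | k) [j m] = alpha^m [k m]],

    their q-factorial moments ([qHahn_moment]). *)

(** * Gaussian binomials and the q-Hahn weights *)

(** The recursive form makes sense for every [q], roots of unity included, and
    vanishes for [m > n], which the quotient of q-factorials does not. *)
Fixpoint qbinom (K : pzRingType) (q : K) (n m : nat) : K :=
  match n, m with
  | _, 0 => 1
  | 0, _.+1 => 0
  | n'.+1, m'.+1 => qbinom q n' m' + q ^+ m * qbinom q n' m
  end.

#[global] Arguments qbinom : simpl never.

Section GaussianBinomials.
Variables (K : fieldType) (q : K).

Lemma qbinom0 n : qbinom q n 0 = 1.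
Proof. by case: n. Qed.

Lemma qbinomS n m :
  qbinom q n.+1 m.+1 = qbinom q n m + q ^+ m.+1 * qbinom q n m.+1.
Proof. by []. Qed.

Lemma qbinom_small n m : (n < m)%N -> qbinom q n m = 0.
Proof.
elim: n m => [|n IH] [|m] // nm; rewrite qbinomS !IH ?mulr0 ?addr0 //.
exact: ltnW.
Qed.

Lemma qbinomn n : qbinom q n n = 1.
Proof. by elim: n => // n IH; rewrite qbinomS IH qbinom_small // mulr0 addr0. Qed.

Lemma qbinomS_dual n m : (m <= n)%N ->
  qbinom q n.+1 m.+1 = qbinom q n m.+1 + q ^+ (n - m) * qbinom q n m.
Proof.
elim: n m => [|n IH] m.
  by rewrite leqn0 => /eqP->; rewrite !qbinomn qbinom_small // mulr1 add0r.
case: m => [_|m mn].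
  by rewrite qbinomS [in LHS]IH // [in RHS]qbinomS !qbinom0 !subn0 !exprS; ring.
rewrite ltnS in mn; rewrite qbinomS [in LHS]IH // [in RHS]qbinomS subSS.
move: mn; rewrite leq_eqVlt => /predU1P[->|mn].
  rewrite subnn !qbinomn (@qbinom_small n n.+1) // (@qbinom_small n n.+2) //.
  rewrite (@qbinom_small n.+1 n.+2) //; ring.
rewrite IH // [in RHS]qbinomS.
have -> : (n - m = (n - m.+1).+1)%N by rewrite -subSn.
rewrite !exprS; ring.
Qed.

(** The inductive step of the q-binomial theorem: [t m] plays the role of
    [E1^m E0^(k + 1 - m)], and left multiplication by [E0 + y E1] sends
    [E1^m E0^(k - m)] to [q^m t m + y t (m + 1)] when [E0 E1 = q E1 E0]. *)
Lemma qbinom_sumS y k (t : nat -> K) :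
  \sum_(m < k.+1) (y ^+ m * qbinom q k m * q ^+ m * t m +
                    y ^+ m.+1 * qbinom q k m * t m.+1) =
  \sum_(m < k.+2) y ^+ m * qbinom q k.+1 m * t m.
Proof.
rewrite big_split /= [RHS]big_ord_recl [X in X + _ = _]big_ord_recl /= -addrA.
rewrite !qbinom0 !expr0 !mulr1; congr (_ + _).
transitivity (\sum_(m < k.+1) y ^+ m.+1 * qbinom q k m.+1 * q ^+ m.+1 * t m.+1 +
   \sum_(m < k.+1) y ^+ m.+1 * qbinom q k m * t m.+1).
  congr (_ + _); rewrite [RHS]big_ord_recr /= qbinom_small //.
  by rewrite mulr0 !mul0r addr0.
rewrite -big_split /=; apply: eq_bigr => m _.
rewrite /bump /= add1n qbinomS; ring.
Qed.

Lemma qPochhammerS b n :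
  qPochhammer q b n.+1 = qPochhammer q b n * (1 - b * q ^+ n).
Proof. by rewrite /qPochhammer big_ord_recr. Qed.

Lemma qPochhammer0 b : qPochhammer q b 0 = 1.
Proof. by rewrite /qPochhammer big_ord0. Qed.

Lemma qbinom_qPochhammer n m : (m <= n)%N ->
  qbinom q n m * (qPochhammer q q (n - m) * qPochhammer q q m) =
  qPochhammer q q n.
Proof.
elim: n m => [|n IH] m.
  by rewrite leqn0 => /eqP->; rewrite qbinom0 !qPochhammer0 !mul1r.
case: m => [_|m]; first by rewrite qbinom0 qPochhammer0 mulr1 mul1r.
rewrite ltnS leq_eqVlt => /predU1P[->|mn].
  by rewrite subnn qPochhammer0 qbinomn !mul1r.
rewrite qbinomS subSS [RHS]qPochhammerS.
have Enm : (n - m = (n - m.+1).+1)%N by rewrite -subSn.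
have E1 := IH m (ltnW mn); have E2 := IH m.+1 mn.
have Eq : q ^+ n = q ^+ (n - m.+1) * q ^+ m.+1 by rewrite -exprD subnK.
have -> : qPochhammer q q n * (1 - q * q ^+ n) =
   qPochhammer q q n * (1 - q ^+ m.+1)
   + q ^+ m.+1 * (1 - q ^+ (n - m)) * qPochhammer q q n.
  rewrite Enm Eq !exprS; ring.
rewrite -{1}E1 -E2 Enm !qPochhammerS !exprS; ring.
Qed.

(** The weight [qphi] with its quotient replaced by a Gaussian binomial, so
    that its recurrences hold without restriction on [q] and up to [j = k + 1]. *)
Definition qHahn (a : K) (j k : nat) : K :=
  a ^+ j * qPochhammer q a (k - j) * qbinom q k j.

Lemma qHahn_small a j k : (k < j)%N -> qHahn a j k = 0.
Proof. by move=> kj; rewrite /qHahn qbinom_small ?mulr0. Qed.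

Lemma qPochhammer_neq0 k n : (forall m, (0 < m <= k)%N -> q ^+ m != 1) ->
  (n <= k)%N -> qPochhammer q q n != 0.
Proof.
move=> qk; elim: n => [|n IH] nk; first by rewrite qPochhammer0 oner_eq0.
rewrite qPochhammerS mulf_neq0 ?IH 1?ltnW // -exprS subr_eq0 eq_sym.
by rewrite qk.
Qed.

Lemma qphiE a j k : (forall m, (0 < m <= k)%N -> q ^+ m != 1) ->
  (j <= k)%N -> qphi q a j k = qHahn a j k.
Proof.
move=> qk jk; rewrite /qphi /qHahn -(qbinom_qPochhammer jk) mulfK //.
by rewrite mulf_neq0 ?(qPochhammer_neq0 qk) ?leq_subr.
Qed.

Lemma qHahn0S a k : qHahn a 0 k.+1 = qHahn a 0 k * (1 - a * q ^+ k).
Proof. rewrite /qHahn !qbinom0 !subn0 qPochhammerS; ring. Qed.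

Lemma qHahnSS a j k : (j <= k)%N ->
  qHahn a j.+1 k.+1 = qHahn a j.+1 k * (1 - a * q ^+ (k - j.+1))
                      + a * q ^+ (k - j) * qHahn a j k.
Proof.
rewrite leq_eqVlt => /predU1P[->|jk].
  rewrite [qHahn _ k.+1 k]qHahn_small // /qHahn !subnn !qbinomn.
  rewrite !qPochhammer0 !exprS; ring.
rewrite /qHahn subSS qbinomS_dual 1?ltnW //.
have -> : (k - j = (k - j.+1).+1)%N by rewrite -subSn.
rewrite qPochhammerS !exprS; ring.
Qed.

(** Formally the weights are the law of a Markov chain started at [0]: from
    time [k] to time [k + 1] the index [j] is raised by one with probability
    [a q^(k - j)].  The sum on the right conditions on the state at time [k]. *)
Lemma qHahn_sumS a k (c : nat -> K) :
  \sum_(j < k.+2) qHahn a j k.+1 * c j =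
  \sum_(j < k.+1) qHahn a j k *
     ((1 - a * q ^+ (k - j)) * c j + a * q ^+ (k - j) * c j.+1).
Proof.
rewrite big_ord_recl /= /bump /=.
under eq_bigr => j _ do rewrite add1n (qHahnSS _ (leq_ord j)) mulrDl.
rewrite big_split /= addrA qHahn0S.
under [RHS]eq_bigr => j _ do rewrite mulrDr.
rewrite big_split /=; congr (_ + _); last first.
  by apply: eq_bigr => j _; ring.
rewrite big_ord_recr /= (@qHahn_small a k.+1) // !mul0r addr0 [RHS]big_ord_recl /= subn0.
congr (_ + _); first by rewrite mulrA.
by apply: eq_bigr => j _; rewrite /bump /= add1n mulrA.
Qed.

(** The q-factorial moments of the weights.  One step of the chain raises the
    [m+1]-st moment by [a q^(k - m)] times the [m]-th one, because
    [q^(k - j) ([j+1 m+1] - [j m+1]) = q^(k - m) [j m]]; the dual Pascal rule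
    gives the right-hand side the same recurrence.  The case [m = 0] says that
    the weights sum to 1. *)
Lemma qHahn_moment a k m :
  \sum_(j < k.+1) qHahn a j k * qbinom q j m = a ^+ m * qbinom q k m.
Proof.
elim: k m => [|k IH] m.
  rewrite big_ord1 /qHahn /= subnn qPochhammer0 qbinom0 expr0 !mul1r.
  by case: m => [|m]; rewrite ?expr0 ?mul1r // qbinom_small // mulr0.
rewrite (qHahn_sumS a k (fun j => qbinom q j m)).
case: m => [|m].
  rewrite qbinom0 -(qbinom0 k) -(IH 0); apply: eq_bigr => j _.
  rewrite !qbinom0; ring.
have [mk|km] := leqP m k; last first.
  rewrite qbinom_small ?mulr0 //; apply: big1 => j _.
  have jm : (j < m)%N by rewrite (leq_trans (ltn_ord j)).
  by rewrite !qbinom_small ?mulr0 ?addr0 ?mulr0 // ltnS // ltnW.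
rewrite qbinomS_dual // mulrDr -IH exprS.
(* The increment of the moment is folded back with the induction hypothesis
   at [m]. *)
have -> : a * a ^+ m * (q ^+ (k - m) * qbinom q k m) =
          a * q ^+ (k - m) * (a ^+ m * qbinom q k m) by ring.
rewrite -IH mulr_sumr -big_split /=; apply: eq_bigr => j _.
have [mj|jm] := leqP m j; last first.
  rewrite (@qbinom_small j m) // (@qbinom_small j m.+1) 1?ltnW //.
  rewrite (@qbinom_small j.+1 m.+1) //; ring.
have -> : (k - m = (k - j) + (j - m))%N by rewrite addnBA ?subnK // -ltnS.
rewrite qbinomS_dual // exprD; ring.
Qed.

End GaussianBinomials.

(** * Rational identities behind the coefficients *)

Section RationalIdentities.
Variable K : fieldType.
Implicit Types x y P Q : K.

Lemma drop_factor x y P : x != 0 -> x - y != 0 ->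
  P = (1 - y / x) * (x / (x - y) * P).
Proof. by move=> x0 xy; field; rewrite x0 xy. Qed.

(** The relation [E0 E1 = q E1 E0] for two variables [x] and [y]; the factors
    [P1] and [P2] stand for the contribution of the others. *)
Lemma exchange_factor x y Q P1 P2 :
  Q * y - x != 0 -> Q * x - y != 0 -> y - x != 0 -> x - y != 0 ->
  y / (y - x) * P1 * (Q * x / (Q * x - y) * P2) * (y - Q * x) +
  x / (x - y) * P2 * (Q * y / (Q * y - x) * P1) * (x - Q * y) = 0.
Proof. by move=> Qyx Qxy yx xy; field; rewrite Qyx Qxy yx xy. Qed.

End RationalIdentities.

(** * The shifts as commuting field automorphisms *)

Section Shifts.
Variables (F : fieldType) (n : nat) (q : F).
Hypothesis q_neq0 : q != 0.
Implicit Types (i j l : 'I_n) (f g : ratfun F n).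

(** Monomials are eigenvectors, so all the shifts are diagonal in the same
    basis and commute. *)
Lemma mpoly_qshift_monomial i m :
  mpoly_qshift q i 'X_[m] = q ^+ m i *: 'X_[F, m].
Proof.
rewrite /mpoly_qshift comp_mpolyX mpolyXE_id (bigD1 i) //= [in RHS](bigD1 i) //=.
rewrite tnth_mktuple eqxx exprZn -scalerAl; congr (_ *: (_ * _)).
by apply: eq_bigr => l li; rewrite tnth_mktuple (negPf li).
Qed.

Lemma mpoly_qshiftC i j (p : {mpoly F[n]}) :
  mpoly_qshift q i (mpoly_qshift q j p) = mpoly_qshift q j (mpoly_qshift q i p).
Proof.
have sD l a (m : 'X_{1..n}) p' : mpoly_qshift q l (a *: 'X_[m] + p') =
    (a * q ^+ m l) *: 'X_[m] + mpoly_qshift q l p'.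
  rewrite -scalerA -mpoly_qshift_monomial.
  by rewrite /mpoly_qshift comp_mpolyD comp_mpolyZ.
elim/mpolyind: p => [|c m p _ _ IH]; first by rewrite /mpoly_qshift !comp_mpoly0.
by rewrite !sD IH mulrAC.
Qed.

Lemma qshift_tofrac i (p : {mpoly F[n]}) :
  qshift q i (FracField.tofrac p) = FracField.tofrac (mpoly_qshift q i p).
Proof.
have := qshift_frac i q_neq0 p (oner_neq0 _).
by rewrite /mpoly_qshift comp_mpoly1 tofrac1 !divr1.
Qed.

Lemma qshift_ratX i j :
  qshift q i (ratX F j) = (if j == i then ratC n q else 1) * ratX F j.
Proof.
rewrite /ratX qshift_tofrac mpoly_qshiftX; case: ifP => _; rewrite ?mul1r //.
by rewrite /ratC -tofracM mul_mpolyC.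
Qed.

Lemma qshift_ratC i c : qshift q i (ratC n c) = ratC n c.
Proof. by rewrite /ratC qshift_tofrac /mpoly_qshift comp_mpolyC. Qed.

Lemma qshift0 i : qshift q i 0 = 0.
Proof. by rewrite -tofrac0 qshift_tofrac /mpoly_qshift comp_mpoly0. Qed.

Lemma qshift1 i : qshift q i 1 = 1.
Proof. by rewrite -tofrac1 qshift_tofrac /mpoly_qshift comp_mpoly1. Qed.

Lemma qshiftM i f g : qshift q i (f * g) = qshift q i f * qshift q i g.
Proof.
have df := denom_ratioP (repr f); have dg := denom_ratioP (repr g).
rewrite [f]ratfunE [g]ratfunE mulf_div -!tofracM !qshift_frac ?mulf_neq0 //.
by rewrite mulf_div -!tofracM /mpoly_qshift -!rmorphM.
Qed.

Lemma qshiftD i f g : qshift q i (f + g) = qshift q i f + qshift q i g.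
Proof.
have df := denom_ratioP (repr f); have dg := denom_ratioP (repr g).
rewrite [f]ratfunE [g]ratfunE addf_div ?tofrac_eq0 // -!tofracM -tofracD.
rewrite !qshift_frac ?mulf_neq0 // addf_div ?tofrac_eq0 ?mpoly_qshift_eq0 //.
by rewrite -!tofracM -!tofracD /mpoly_qshift -!rmorphM -!rmorphD.
Qed.

Lemma qshiftN i f : qshift q i (- f) = - qshift q i f.
Proof. by apply/eqP; rewrite -addr_eq0 -qshiftD addNr qshift0. Qed.

Lemma qshiftB i f g : qshift q i (f - g) = qshift q i f - qshift q i g.
Proof. by rewrite qshiftD qshiftN. Qed.

Lemma qshiftV i f : qshift q i f^-1 = (qshift q i f)^-1.
Proof.
have [->|f0] := eqVneq f 0; first by rewrite invr0 qshift0 invr0.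
have : qshift q i f * qshift q i f^-1 = 1 by rewrite -qshiftM divff // qshift1.
by move/mulr1_eq.
Qed.

Lemma qshiftX i f m : qshift q i (f ^+ m) = qshift q i f ^+ m.
Proof. by elim: m => [|m IH]; rewrite ?expr0 ?qshift1 // !exprS qshiftM IH. Qed.

Lemma qshift_sum i (I : Type) (r : seq I) P (h : I -> ratfun F n) :
  qshift q i (\sum_(s <- r | P s) h s) = \sum_(s <- r | P s) qshift q i (h s).
Proof. exact: (big_morph _ (qshiftD i) (qshift0 i)). Qed.

Lemma qshift_prod i (I : Type) (r : seq I) P (h : I -> ratfun F n) :
  qshift q i (\prod_(s <- r | P s) h s) = \prod_(s <- r | P s) qshift q i (h s).
Proof. exact: (big_morph _ (qshiftM i) (qshift1 i)). Qed.

Lemma qshift_comm i j f :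
  qshift q i (qshift q j f) = qshift q j (qshift q i f).
Proof.
rewrite [f]ratfunE; move: \n_(repr f) \d_(repr f) (denom_ratioP (repr f)).
move=> p d d0; have sd0 l : mpoly_qshift q l d != 0 by rewrite mpoly_qshift_eq0.
rewrite (qshift_frac j q_neq0 p d0) (qshift_frac i q_neq0 p d0).
rewrite (qshift_frac i q_neq0 _ (sd0 j)) (qshift_frac j q_neq0 _ (sd0 i)).
by rewrite (mpoly_qshiftC i j p) (mpoly_qshiftC i j d).
Qed.

Lemma qshift_qbinom i k m :
  qshift q i (qbinom (ratC n q) k m) = qbinom (ratC n q) k m.
Proof.
elim: k m => [|k IH] [|m]; rewrite ?qbinom0 ?qshift1 //.
  by rewrite qbinom_small // qshift0.
by rewrite qbinomS qshiftD qshiftM !IH qshiftX qshift_ratC.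
Qed.

Lemma ratX_neq0 i : ratX F i != 0.
Proof. by rewrite tofrac_eq0 -msupp_eq0 msuppX. Qed.

Lemma ratC_exp (c : F) m : ratC n c ^+ m = ratC n (c ^+ m).
Proof. by rewrite /ratC -tofracXn -rmorphXn. Qed.

Lemma ratC_eq1 (c : F) : (ratC n c == 1) = (c == 1).
Proof. by rewrite -tofrac1 tofrac_eq -mpolyC1 mpolyC_eq. Qed.

Lemma ratC_ratX_neq (c : F) i j : i != j -> ratC n c * ratX F i != ratX F j.
Proof.
move=> ij; rewrite /ratC /ratX -tofracM tofrac_eq mul_mpolyC.
apply/eqP => /(congr1 (fun p : {mpoly F[n]} => p@_U_(j)%MM)) /eqP.
by rewrite mcoeffZ !mcoeffXU eqxx (negPf ij) mulr0 eq_sym oner_eq0.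
Qed.

Lemma ratX_neq i j : i != j -> ratX F i != ratX F j.
Proof. by move/(@ratC_ratX_neq 1); rewrite /ratC tofrac1 mul1r. Qed.

(** * First-order q-difference operators *)

Definition qdiff (c : 'I_n -> ratfun F n) f : ratfun F n :=
  \sum_l c l * qshift q l f.

Lemma qdiff_sum c (I : Type) (r : seq I) P (h : I -> ratfun F n) :
  qdiff c (\sum_(s <- r | P s) h s) = \sum_(s <- r | P s) qdiff c (h s).
Proof.
rewrite exchange_big /=; apply: eq_bigr => l _.
by rewrite qshift_sum mulr_sumr.
Qed.

(** Only the shifts that do occur in the operator must fix the scalar; this is
    what lets [x_i] pass through the operator that omits [x_i]. *)
Lemma qdiff_scale c a f : (forall l, c l != 0 -> qshift q l a = a) ->
  qdiff c (a * f) = a * qdiff c f.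
Proof.
move=> ha; rewrite /qdiff mulr_sumr; apply: eq_bigr => l _.
have [->|cl] := eqVneq (c l) 0; first by rewrite !mul0r mulr0.
by rewrite qshiftM ha // mulrCA.
Qed.

Definition wcoef (i : 'I_n) : ratfun F n :=
  \prod_(j | j != i) (ratX F j / (ratX F j - ratX F i)).

Notation E0 := (qdiff wcoef).
Notation E1 := (qdiff (fun l => ratX F l * wcoef l)).

Lemma qWhittaker_setT f : qWhittaker q [set: 'I_n] f = E0 f.
Proof.
rewrite /qWhittaker; apply: eq_big => [i|i _]; first by rewrite inE.
by congr (_ * _); apply: eq_bigl => j; rewrite inE.
Qed.

(** Dropping the variable [x_i] multiplies the coefficient of [Gamma_l] by
    [1 - x_l / x_i], which also kills the term [l = i]. *)
Lemma qWhittaker_setC1 i f :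
  qWhittaker q [set~ i] f =
  qdiff (fun l => (1 - ratX F l / ratX F i) * wcoef l) f.
Proof.
rewrite /qWhittaker /qdiff [RHS](bigD1 i) //=.
rewrite divff ?ratX_neq0 // subrr !mul0r add0r.
apply: eq_big => [l|l]; rewrite !inE // => li; congr (_ * _).
(* The factor of [j = i] in [w_l] is the one that has to cancel. *)
rewrite /wcoef [in RHS](bigD1 i) 1?eq_sym //=.
rewrite (eq_bigl (fun j => (j != l) && (j != i))); last first.
  by move=> j; rewrite !inE andbC.
have il : ratX F i - ratX F l != 0 by rewrite subr_eq0 ratX_neq // eq_sym.
exact: drop_factor (ratX_neq0 i) il.
Qed.

(** Pairing the two orders of each pair of indices keeps this valid in
    characteristic 2, where comparing the sum with its opposite proves nothing. *)
Lemma sum_antisym (V : zmodType) (c : 'I_n -> 'I_n -> V) :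
  (forall i, c i i = 0) -> (forall i j, (i < j)%N -> c i j + c j i = 0) ->
  \sum_i \sum_j c i j = 0.
Proof.
move=> c0 cS.
pose u i j := if (i < j)%N then c i j else 0.
pose v i j := if (j < i)%N then c i j else 0.
transitivity (\sum_i \sum_j (u i j + v i j)).
  apply: eq_bigr => i _; apply: eq_bigr => j _; rewrite /u /v.
  by case: ltngtP => [||/val_inj->]; rewrite ?addr0 ?add0r ?c0.
under eq_bigr => i _ do rewrite big_split /=.
rewrite big_split /= [X in _ + X]exchange_big -big_split /=.
apply: big1 => i _; rewrite -big_split /=; apply: big1 => j _; rewrite /u /v.
by case: ifP => [/cS //|]; rewrite addr0.
Qed.

Lemma wcoefD1 i j : i != j ->
  wcoef i = ratX F j / (ratX F j - ratX F i) *
    \prod_(l | (l != i) && (l != j)) (ratX F l / (ratX F l - ratX F i)).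
Proof. by move=> ij; rewrite /wcoef (bigD1 j) // eq_sym. Qed.

Lemma qshift_wcoef i j : i != j ->
  qshift q i (wcoef j) =
    ratC n q * ratX F i / (ratC n q * ratX F i - ratX F j) *
    \prod_(l | (l != i) && (l != j)) (ratX F l / (ratX F l - ratX F j)).
Proof.
move=> ij; rewrite (@wcoefD1 j i) 1?eq_sym // qshiftM qshift_prod.
rewrite !(qshiftM, qshiftV, qshiftB, qshift_ratX) eqxx eq_sym (negPf ij) mul1r.
congr (_ * _); apply: eq_big => [l|l /andP[_ li]]; first by rewrite andbC.
rewrite !(qshiftM, qshiftV, qshiftB, qshift_ratX) (negPf li) eq_sym (negPf ij).
by rewrite !mul1r.
Qed.

(** This is the coefficient of [Gamma_i Gamma_j] in [E0 E1 - q E1 E0].  The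
    variables other than [x_i] and [x_j] contribute the same factor to both
    terms, so that the identity reduces to rank two. *)
Lemma wcoef_exchange i j : i != j ->
  wcoef i * qshift q i (wcoef j) * (ratX F j - ratC n q * ratX F i) +
  wcoef j * qshift q j (wcoef i) * (ratX F i - ratC n q * ratX F j) = 0.
Proof.
move=> ij; have ji : j != i by rewrite eq_sym.
have swapP G : \prod_(l | (l != j) && (l != i)) G l =
    \prod_(l | (l != i) && (l != j)) G l :> ratfun F n.
  by apply: eq_bigl => l; rewrite andbC.
rewrite !qshift_wcoef // (wcoefD1 ij) (wcoefD1 ji) !swapP.
have := ratX_neq ij; have := ratX_neq ji.
have := ratC_ratX_neq q ij; have := ratC_ratX_neq q ji.
rewrite -!(subr_eq0 _ (ratX F _)).
exact: exchange_factor.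
Qed.

(** The coefficient of [Gamma_i^2] in the difference vanishes since
    [Gamma_i x_i = q x_i Gamma_i]; the terms with [i != j] cancel in pairs. *)
Lemma qdiff_qcomm f : E0 (E1 f) = ratC n q * E1 (E0 f).
Proof.
apply/eqP; rewrite -subr_eq0 /qdiff mulr_sumr -sumrB; apply/eqP.
transitivity (\sum_i \sum_j wcoef i * qshift q i (wcoef j) *
   (qshift q i (ratX F j) - ratC n q * ratX F i) *
   qshift q i (qshift q j f)).
  apply: eq_bigr => i _; rewrite !qshift_sum !mulr_sumr -sumrB.
  by apply: eq_bigr => j _; rewrite !qshiftM; ring.
apply: sum_antisym => [i|i j ij].
  by rewrite qshift_ratX eqxx subrr mulr0 mul0r.
have nij : i != j by apply: contraTneq ij => ->; rewrite ltnn.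
rewrite (qshift_comm j i) -mulrDl !qshift_ratX eq_sym (negPf nij).
by rewrite !mul1r wcoef_exchange // mul0r.
Qed.

Lemma qdiff_qcomm_iter m f :
  E0 (iter m E1 f) = ratC n q ^+ m * iter m E1 (E0 f).
Proof.
elim: m => [|m IH]; first by rewrite expr0 mul1r.
rewrite !iterS qdiff_qcomm IH qdiff_scale => [|l _].
  by rewrite mulrA -exprS.
by rewrite qshiftX qshift_ratC.
Qed.

(** The q-binomial theorem for [E0 - x_i^-1 E1].  Multiplying on the left by
    this operator is harmless in the induction: [x_i] and the Gaussian binomials
    pass through it. *)
Lemma qWhittaker_setC1_iter i k f :
  iter k (qWhittaker q [set~ i]) f =
  \sum_(m < k.+1) (- (ratX F i)^-1) ^+ m * qbinom (ratC n q) k m *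
     iter m E1 (iter (k - m) E0 f).
Proof.
elim: k => [|k IH]; first by rewrite big_ord1 /= expr0 !mul1r.
rewrite iterS IH qWhittaker_setC1 qdiff_sum.
set y := - (ratX F i)^-1; set Q := ratC n q.
pose t (m : nat) : ratfun F n := iter m E1 (iter (k.+1 - m) E0 f).
transitivity (\sum_(m < k.+1) (y ^+ m * qbinom Q k m * Q ^+ m * t m +
                               y ^+ m.+1 * qbinom Q k m * t m.+1)).
  apply: eq_bigr => m _; rewrite qdiff_scale; last first.
    move=> l; have [->|li _] := eqVneq l i.
      by rewrite divff ?ratX_neq0 // subrr mul0r eqxx.
    rewrite qshiftM qshift_qbinom /y qshiftX qshiftN qshiftV qshift_ratX.
    by rewrite eq_sym (negPf li) mul1r.
  have Ed g : qdiff (fun l => (1 - ratX F l / ratX F i) * wcoef l) g =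
              E0 g + y * E1 g.
    rewrite /qdiff mulr_sumr -big_split /=; apply: eq_bigr => l _.
    rewrite /y; ring.
  have E1t : E1 (iter m E1 (iter (k - m) E0 f)) = t m.+1 by rewrite /t subSS.
  have E0t : iter m E1 (E0 (iter (k - m) E0 f)) = t m.
    by rewrite /t subSn ?leq_ord.
  rewrite Ed qdiff_qcomm_iter E1t E0t exprS; ring.
exact: qbinom_sumS.
Qed.

End Shifts.

Theorem proposition2p2 (F : fieldType) (q : F) (N k : nat)
    (q_neq0 : q != 0)
    (q_generic : forall m : nat, (0 < m <= k)%N -> q ^+ m != 1)
    (N_gt0 : (0 < N)%N) (k_gt0 : (0 < k)%N) :
  let iN : 'I_N.+1 := inord N.-1 in
  let iN1 : 'I_N.+1 := ord_max in
  let DN := qWhittaker q [set~ iN1] in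
  let DN1 := qWhittaker q [set: 'I_N.+1] in
  let DtN := qWhittaker q [set~ iN] in
  let alpha := ratX F iN1 / ratX F iN in
  forall f : ratfun F N.+1,
    iter k DtN f =
    \sum_(j < k.+1)
      qphi (ratC N.+1 q) alpha j k * iter j DN (iter (k - j) DN1 f).
Proof.
move=> iN iN1 DN DN1 DtN alpha f; set Q := ratC N.+1 q.
pose y (i : 'I_N.+1) := - (ratX F i)^-1.
pose E0 := qdiff q (@wcoef F N.+1).
pose E1 := qdiff q (fun l => ratX F l * @wcoef F N.+1 l).
pose t (m : nat) := iter m E1 (iter (k - m) E0 f).
have Qk m : (0 < m <= k)%N -> Q ^+ m != 1.
  by move=> mk; rewrite ratC_exp ratC_eq1 q_generic.
(* The power of [E0] applied first only lengthens the tail of each term, so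
   every [j] leads to the same [t m]; the terms with [m > j] are zero. *)
have DNE (j : 'I_k.+1) : iter j DN (iter (k - j) DN1 f) =
    \sum_(m < k.+1) y iN1 ^+ m * qbinom Q j m * t m.
  rewrite (@eq_iter _ DN1 E0); last exact: qWhittaker_setT.
  have jk : (j <= k)%N by rewrite -ltnS.
  rewrite qWhittaker_setC1_iter // (big_ord_widen k.+1
    (fun m => y iN1 ^+ m * qbinom Q j m * iter m E1 (iter (j - m) E0
      (iter (k - j) E0 f)))) // big_mkcond /=; apply: eq_bigr => m _.
  case: ifP => [mj|/negbT]; last first.
    by rewrite -leqNgt => jm; rewrite qbinom_small // mulr0 mul0r.
  by rewrite -iterD /t addnC addnBA // subnK.
rewrite qWhittaker_setC1_iter //.
under [RHS]eq_bigr => j _ do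
  rewrite (qphiE _ Qk (leq_ord j)) DNE mulr_sumr.
rewrite exchange_big /=; apply: eq_bigr => m _.
transitivity (y iN1 ^+ m * (\sum_(j < k.+1) qHahn Q alpha j k * qbinom Q j m)
              * t m).
  rewrite qHahn_moment mulrA -exprMn; congr (_ ^+ _ * _ * _).
  by rewrite /y /alpha mulNr mulKf // ratX_neq0.
rewrite mulr_sumr mulr_suml; apply: eq_bigr => j _.
by rewrite (mulrCA (y iN1 ^+ m)) -!mulrA.
Qed.
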